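(* Let $m>M\ge1$ be integers and let $\mathscr{G}_1,\dots,\mathscr{G}_N$ be independent random weighted symmetric $2M$-uniform hypergraphs on $m$ vertices whose Laplacian tensors $\mathcal{L}_1,\dots,\mathcal{L}_N\in\mathbb{R}^{m^{2M}}$ are Hermitian with $\mathbb{E}\mathcal{L}_i=\mathcal{O}$ and $\lambda_{\max}(\mathcal{L}_i)\le1$ almost surely for each $i$. Let $\overline{\mathscr{G}}$ be the ensemble hypergraph, with Laplacian tensor $\mathcal{L}_{\overline{\mathscr{G}}}=\sum_{i=1}^N\mathcal{L}_i$, and define the positive number $$\sigma^2_{\overline{\mathscr{G}}}=\lambda_{\frac{m!}{(m-M)!}-1}\Big(\sum_{i=1}^N\mathbb{E}\mathcal{L}_i^2\Big).$$ Then for every $\theta>0$ the algebraic connectivity $\alpha(\overline{\mathscr{G}})$ satisfies $$\mathrm{Pr}\big(\alpha(\overline{\mathscr{G}})\ge\theta\big)\le\Big(m^M-\frac{m!}{(m-M)!}+2\Big)\exp(\theta)\left(1+\frac{\theta}{\sigma^2_{\overline{\mathscr{G}}}}\right)^{-(\theta+\sigma^2_{\overline{\mathscr{G}}})}.$$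
   Context: Tensors. A tensor in $\mathbb{R}^{m^{2M}}$ is an array with entries indexed by $(i_1,\dots,i_M,j_1,\dots,j_M)\in[m]^{2M}$, viewed as a linear operator on $\mathbb{R}^{m^M}$ through $(\mathcal{L}\star_M\mathcal{X})_{i_1,\dots,i_M}=\sum_{j_1,\dots,j_M}\mathcal{L}_{i_1,\dots,i_M,j_1,\dots,j_M}\mathcal{X}_{j_1,\dots,j_M}$; $\mathcal{L}^2=\mathcal{L}\star_M\mathcal{L}$ is the operator composition. It is Hermitian if invariant under conjugate transposition, which exchanges the blocks $(i_1,\dots,i_M)$ and $(j_1,\dots,j_M)$. $\lambda_k(\cdot)$ is the $k$-th largest eigenvalue (with multiplicity) and $\lambda_{\max}$ the largest eigenvalue of a Hermitian tensor; $\mathcal{O}$ is the zero tensor; expectation is entrywise. Random hypergraphs. A hypergraph $\mathscr{G}=(\mathscr{V},\mathscr{E})$ has vertex set $\mathscr{V}$ with $m$ elements, identified with $[m]$, and hyperedges that are subsets of $\mathscr{V}$; it is $2M$-uniform if each hyperedge has $2M$ vertices. It is directed: each hyperedge is a disjoint union $E=S\cup D$ of a source part $S$ and a destination part $D$ (here of $M$ vertices each), and carries a real weight. It is weighted symmetric if two hyperedges with the same vertex set and with source and destination interchanged have the same weight. It is a random weighted symmetric $2M$-uniform hypergraph if the weights are random variables. The adjacency tensor $\mathcal{A}_{\mathscr{G}}\in\mathbb{R}^{m^{2M}}$ has entry $a_{i_1,\dots,i_M,j_1,\dots,j_M}$ equal to the weight of the hyperedge with source $\{i_1,\dots,i_M\}$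 and destination $\{j_1,\dots,j_M\}$, and $0$ if there is no such hyperedge (in particular if there are repeated indices). The degree tensor $\mathcal{D}_{\mathscr{G}}$ is the diagonal tensor with $d_{i_1,\dots,i_M,i_1,\dots,i_M}=\sum_{j_1,\dots,j_M=1}^m a_{i_1,\dots,i_M,j_1,\dots,j_M}$. The Laplacian tensor is $\mathcal{L}_{\mathscr{G}}=\mathcal{D}_{\mathscr{G}}-\mathcal{A}_{\mathscr{G}}$. Algebraic connectivity. $\alpha(\mathscr{G})=\min\{\mathcal{X}^{\mathrm T}\star_M\mathcal{L}_{\mathscr{G}}\star_M\mathcal{X}:\ \mathcal{X}\in\mathbb{R}^{m^M},\ \|\mathcal{X}\|=1,\ \mathcal{X}\perp\mathcal{E}\}$, where $\|\cdot\|$ is the Frobenius norm and $\mathcal{E}\subseteq\mathbb{R}^{m^M}$ is the subspace spanned by the all-one tensor and by the coordinate tensors at positions $(i_1,\dots,i_M)$ with a repeated index (both are eigen-tensors with eigenvalue zero). For the ensemble hypergraph, $\alpha(\overline{\mathscr{G}})$ is given by this formula with $\mathcal{L}_{\overline{\mathscr{G}}}=\sum_{i=1}^N\mathcal{L}_i$. *)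

(* Defs.v *)
From HB Require Import structures.
From mathcomp Require Import all_boot all_order all_algebra.
From mathcomp Require Import all_classical all_reals all_analysis.

Set Implicit Arguments.
Unset Strict Implicit.
Unset Printing Implicit Defensive.

Import Order.TTheory GRing.Theory Num.Theory.

Local Open Scope classical_set_scope.
Local Open Scope ring_scope.

Definition mindex (m M : nat) := M.-tuple 'I_m.

(* The scalars are R^o (convertible to R) so that both types are modules
   over R. *)
Notation tensor1 R m M := {ffun mindex m M -> R^o}.
Notation tensor2 R m M := {ffun mindex m M * mindex m M -> R^o}.

Section Tensors.
Variables (R : realType) (m M : nat).
Implicit Types (X Y : tensor1 R m M) (L K : tensor2 R m M).

Definition tapply L X : tensor1 R m M :=
  [ffun i => \sum_j L (i, j) * X j].

Definition tmul L K : tensor2 R m M :=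
  [ffun p => \sum_j L (p.1, j) * K (j, p.2)].

Definition tinner X Y : R := \sum_i X i * Y i.

Definition frobenius X : R := Num.sqrt (tinner X X).

(* Real entries: conjugate transposition only exchanges the index blocks. *)
Definition thermitian L := forall i j : mindex m M, L (i, j) = L (j, i).

Definition unfolding L : 'M[R]_#|{: mindex m M}| :=
  \matrix_(a, b) L (enum_val a, enum_val b).

(* For a Hermitian tensor there is exactly one such list, of length m ^ M, by
   the spectral theorem and unique factorization; the default [::] is only
   returned when the characteristic polynomial does not split over R. *)
Definition eigenvalues L : seq R :=
  xget [::] [set s : seq R | sorted >=%O s /\
                             char_poly (unfolding L) = \prod_(x <- s) ('X - x%:P)].

(* The k-th largest eigenvalue, counted from k = 1. *)
Definition lambda (k : nat) L : R := nth 0 (eigenvalues L) k.-1.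

Definition lambda_max L : R := lambda 1 L.

Definition all_one : tensor1 R m M := [ffun=> 1].

Definition coordinate (i : mindex m M) : tensor1 R m M :=
  [ffun j => (j == i)%:R].

Definition trivial_space : {vspace tensor1 R m M} :=
  (<[all_one]> + \sum_(i : mindex m M | ~~ uniq i) <[coordinate i]>)%VS.

(* The set is the image of a compact set under a continuous function, and it is
   nonempty as soon as M < m and 0 < M, so that inf is then a minimum. *)
Definition algebraic_connectivity L : R :=
  inf [set q : R | exists X : tensor1 R m M,
    [/\ frobenius X = 1,
        (forall Y, Y \in trivial_space -> tinner X Y = 0)
      & q = tinner X (tapply L X)]].

End Tensors.

(* A directed hyperedge is the pair (S, D) of its source and destination; its
   vertex set S :|: D has 2M elements.  The set of hyperedges is deterministic
   and the weights are random; rweight is only meaningful on hyperedges. *)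
Record random_hypergraph (d : measure_display) (T : measurableType d)
    (R : realType) (P : probability T R) (m M : nat) := RandomHypergraph {
  hedges : {set {set 'I_m} * {set 'I_m}} ;
  hedges_uniform : forall S D : {set 'I_m}, (S, D) \in hedges ->
    [/\ #|S| = M, #|D| = M & S :&: D = finset.set0] ;
  rweight : {set 'I_m} * {set 'I_m} -> {RV P >-> R} ;
  rweight_sym : forall S D : {set 'I_m}, (S, D) \in hedges -> (D, S) \in hedges ->
    forall w : T, rweight (S, D) w = rweight (D, S) w
}.

Section RandomHypergraphs.
Variables (d : measure_display) (T : measurableType d) (R : realType).
Variables (P : probability T R) (m M : nat).
Implicit Types (G : random_hypergraph P m M) (L : T -> tensor2 R m M).

Definition vertices (i : mindex m M) : {set 'I_m} := [set x in tval i]%SET.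

(* A tuple with a repeated index has fewer than M vertices, hence is neither the
   source nor the destination of a hyperedge. *)
Definition adjacency G (w : T) : tensor2 R m M :=
  [ffun p => if (vertices p.1, vertices p.2) \in hedges G
             then rweight G (vertices p.1, vertices p.2) w else 0].

Definition degree G (w : T) : tensor2 R m M :=
  [ffun p => if p.1 == p.2 then \sum_j adjacency G w (p.1, j) else 0].

Definition laplacian G (w : T) : tensor2 R m M :=
  degree G w - adjacency G w.

Definition tsquare L (w : T) : tensor2 R m M :=
  tmul (L w) (L w).

Definition tintegrable L :=
  forall p, P.-integrable [set: T] (fun w => (L w p : R)%:E).

Definition texpectation L : tensor2 R m M :=
  [ffun p => fine ('E_P[fun w => (L w p : R)])%E].

Definition hypergraph_sigma_algebra G : set_system T :=
  <<s [set A | exists2 e, e \in hedges G &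
        exists2 B : set R, measurable B & A = rweight G e @^-1` B] >>.

Definition independent_hypergraphs (N : nat)
    (G : 'I_N -> random_hypergraph P m M) :=
  forall (J : {set 'I_N}) (A : 'I_N -> set T),
    (forall i, i \in J -> hypergraph_sigma_algebra (G i) (A i)) ->
    P (\bigcap_(i in [set` J]) A i) = (\prod_(i in J) P (A i))%E.

Definition ensemble_laplacian (N : nat) (G : 'I_N -> random_hypergraph P m M)
    (w : T) : tensor2 R m M :=
  \sum_(i < N) laplacian (G i) w.

Definition ensemble_sigma2 (N : nat) (G : 'I_N -> random_hypergraph P m M) : R :=
  lambda (m`! %/ (m - M)`! - 1)%N
    (\sum_(i < N) texpectation (tsquare (laplacian (G i)))).

End RandomHypergraphs.

(* Main.v *)
Require Import Defs.
From HB Require Import structures.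
From mathcomp Require Import all_boot all_order all_algebra.
From mathcomp Require Import all_classical all_reals all_analysis.
From mathcomp Require Import measurable_realfun complex ring lra.

(** The algebraic connectivity is a minimum of the quadratic form of the
    Laplacian over unit tensors orthogonal to the trivial space, so it is bounded
    above by the value of the form at any single admissible tensor X.  This
    reduces the tail bound to scalar random variables.

    Let K be the sum of the expectations of the squared Laplacians and choose X
    to be a unit eigentensor of K for sigma2 ([lambda_eigentensor]).  Every
    Laplacian vanishes on the trivial space ([laplacian_trivial]), hence so does
    K; since sigma2 is positive and K is Hermitian, X is orthogonal to the trivial
    space, hence admissible.  Put q_i = <X, L_i X>.  Then
    - the q_i are independent, each being measurable for the sigma-algebra
      generated by the weights of its own hypergraph
      ([hypergraph_sigma_algebra_quadratic]);
    - E q_i = <X, E[L_i] X> = 0 ([integral_tinner_tapply]);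
    - q_i <= lambda_max(L_i) <= 1 almost surely ([rayleigh_le_lambda_max]), which
      is where the spectral theorem enters ([symmetric_spectral]);
    - q_i^2 <= |L_i X|^2 = <X, L_i^2 X> by Cauchy-Schwarz ([tinner_sqr_le]), so the
      variances add up to at most <X, K X> = sigma2.

    The classical scalar Bennett inequality ([bennett]) now bounds the
    probability that the q_i add up to at least theta by
    exp(theta) (1 + theta/sigma2)^-(theta + sigma2).  The dimensional prefactor of the
    statement is at least 1, because the falling factorial m!/(m-M)! is at
    most m^M.

    Two ingredients are of a measure-theoretic nature.  Bennett's inequality
    needs the expectation of a product of functions of independent variables to
    factor ([integral_prod_independent]).  And comparing probabilities requires
    the event that the connectivity is at least theta to be measurable: it is the
    event that a quadratic form with random coefficients is at least theta
    on a fixed set of tensors ([le_algebraic_connectivity],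
    [measurable_forall_quadratic_ge]). *)

Set Implicit Arguments.
Unset Strict Implicit.
Unset Printing Implicit Defensive.

Import Order.TTheory GRing.Theory Num.Theory.
Import numFieldNormedType.Exports.

Local Open Scope classical_set_scope.
Local Open Scope ring_scope.

(** * Exponential inequalities *)

Section ExponentialBound.
Variable R : realType.
Implicit Types x y t : R.

Lemma series_exp_coeff_le_expR x n : 0 <= x -> series (exp_coeff x) n <= expR x.
Proof.
move=> x0; apply: nondecreasing_cvgn_le; last exact: is_cvg_series_exp_coeff.
by apply: nondecreasing_series => i _ _; exact: exp_coeff_ge0.
Qed.

Lemma expR_ge_quadratic x : 0 <= x -> 1 + x + x ^+ 2 / 2 <= expR x.
Proof.
move=> x0; apply: le_trans (series_exp_coeff_le_expR 3 x0).
rewrite /series /= !big_nat_recl//= big_geq// /exp_coeff /= !factS fact0.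
by rewrite expr0 expr1 !divr1 addr0 addrA.
Qed.

(** Taking inverses in [expR_ge_quadratic] at [- x] suffices, since
    (1 + x + x^2/2)(1 - x + x^2/2) = 1 + (x^2/2)^2 >= 1. *)
Lemma expR_le_quadratic x : x <= 0 -> expR x <= 1 + x + x ^+ 2 / 2.
Proof.
move=> x0; have := @expR_ge_quadratic (- x); rewrite oppr_ge0 => /(_ x0).
have := expRxMexpNx_1 x; have := expR_gt0 x.
set e := expR x; set f := expR (- x) => e0 ef1 hf.
have h1 : e * (1 - x + x ^+ 2 / 2) <= 1.
  by rewrite -[leRHS]ef1 ler_wpM2l ?(ltW e0)//; move: hf; rewrite sqrrN.
have p1 : 0 < 1 - x + x ^+ 2 / 2 by nra.
rewrite -(ler_pM2r p1) (le_trans h1)//.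
have -> : (1 + x + x ^+ 2 / 2) * (1 - x + x ^+ 2 / 2) = 1 + (x ^+ 2 / 2) ^+ 2.
  by field.
by rewrite lerDl sqr_ge0.
Qed.

(** The scalar inequality behind Bennett's bound: (e^u - 1 - u) / u^2 is
    nondecreasing in u.  For 0 <= y <= 1 this is visible on the power series,
    because y^i <= y^2 for i >= 2.  For y < 0 the quotient is at most 1/2 at
    t y and at least 1/2 at t. *)
Lemma expR_le_bennett t y : 0 <= t -> y <= 1 ->
  expR (t * y) <= 1 + t * y + (expR t - 1 - t) * y ^+ 2.
Proof.
move=> t0 y1; have [y0|y0] := leP 0 y; last first.
  have ty0 : t * y <= 0 by rewrite mulr_ge0_le0// ltW.
  rewrite (le_trans (expR_le_quadratic ty0))// lerD2l exprMn mulrAC.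
  rewrite ler_wpM2r ?sqr_ge0//.
  by have := expR_ge_quadratic t0; lra.
apply: limr_le; first exact: is_cvg_series_exp_coeff.
near=> n.
have n2 : (2 <= n)%N by near: n; exact: nbhs_infty_ge.
have split_series x : series (exp_coeff x) n =
    1 + x + \sum_(2 <= i < n) exp_coeff x i.
  rewrite /series /= (big_cat_nat (n := 2))//=.
  rewrite !big_nat_recl//= big_geq// /exp_coeff /= !factS fact0.
  by rewrite expr0 expr1 !divr1 addr0.
have := series_exp_coeff_le_expR n t0.
rewrite !split_series lerD2l => tn.
apply: (@le_trans _ _ ((\sum_(2 <= i < n) exp_coeff t i) * y ^+ 2)); last first.
  by rewrite ler_wpM2r ?sqr_ge0//; lra.
rewrite mulr_suml; apply: ler_sum_nat => i /andP[i2 _].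
rewrite /exp_coeff /= exprMn mulrAC ler_wpM2l//.
  by rewrite divr_ge0 ?exprn_ge0.
by rewrite ler_wiXn2l.
Unshelve. all: by end_near. Qed.

End ExponentialBound.

(** * Products of independent random variables *)

Section IndependentProduct.
Context d (T : measurableType d) (R : realType) (P : probability T R).
Import HBNNSimple.

(** The hypothesis says that the measures with densities [W1] and [W2] have the
    same image under [X], so they integrate functions of [X] alike.  The proof
    goes from indicators to simple functions, and then to [g] by monotone
    convergence. *)
Lemma integral_mul_comp_unique d' (U : measurableType d') (X : T -> U)
    (W1 W2 : T -> R) :
  measurable_fun setT X -> measurable_fun setT W1 -> measurable_fun setT W2 ->
  (forall w, 0 <= W1 w) -> (forall w, 0 <= W2 w) ->
  (forall B : set U, measurable B ->
    (\int[P]_w (W1 w * \1_B (X w))%:E = \int[P]_w (W2 w * \1_B (X w))%:E)%E) ->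
  forall g : U -> R, measurable_fun setT g -> (forall x, 0 <= g x) ->
    (\int[P]_w (W1 w * g (X w))%:E = \int[P]_w (W2 w * g (X w))%:E)%E.
Proof.
move=> mX mW1 mW2 W10 W20 eqB g mg g0.
pose gE : U -> \bar R := EFin \o g.
have mg' : measurable_fun setT gE by exact/measurable_EFinP.
pose h := nnsfun_approx measurableT mg'.
have mhX n : measurable_fun setT (h n \o X) by exact: measurableT_comp.
have m1 (r : R) n : measurable_fun setT (\1_(h n @^-1` [set r]) \o X : T -> R).
  by apply: measurableT_comp => //; exact: measurable_indic.
have approx_lim (W : T -> R) : measurable_fun setT W -> (forall w, 0 <= W w) ->
    (\int[P]_w (W w * g (X w))%:E =
     limn (fun n => \int[P]_w (W w * h n (X w))%:E))%E.
  move=> mW W0; rewrite -monotone_convergence//; last 3 first.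
  - by move=> n; apply/measurable_EFinP; apply: measurable_funM => //; exact: mhX.
  - by move=> n x _; rewrite lee_fin mulr_ge0.
  - move=> x _ a b ab; rewrite lee_fin ler_wpM2l//; exact/lefP/nd_nnsfun_approx.
  apply: eq_integral => w _; apply/esym/cvg_lim => //.
  under eq_fun do rewrite EFinM.
  have g0' x : setT x -> (0 <= gE x)%E by move=> _; rewrite lee_fin.
  by rewrite EFinM; exact/cvgeZl/(cvg_nnsfun_approx measurableT mg' g0').
have approx_sum (W : T -> R) n : measurable_fun setT W -> (forall w, 0 <= W w) ->
    (\int[P]_w (W w * h n (X w))%:E = \sum_(r \in range (h n))
      (\int[P]_w (r * (W w * \1_(h n @^-1` [set r]) (X w)))%:E))%E.
  move=> mW W0; rewrite -ge0_integral_fsum//.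
  - apply: eq_integral => w _; rewrite fimfunE fsumEFin//; congr EFin.
    by rewrite mulr_fsumr; apply: eq_fsbigr => r _; rewrite mulrCA.
  - move=> r; apply/measurable_EFinP; apply: measurable_funM => //.
    by apply: measurable_funM => //; exact: m1.
  - move=> r w _; rewrite mulrCA EFinM mule_ge0 ?lee_fin//.
    by have := nnfun_muleindic_ge0 (h n) r (X w); rewrite -EFinM lee_fin.
rewrite !approx_lim//; congr (limn _); apply/funext => n.
rewrite !approx_sum//; apply: eq_fsbigr => r /[!inE] -[x _ hx].
have r0 : 0 <= r by rewrite -hx.
have nn (W : T -> R) : (forall w, 0 <= W w) ->
    forall w, (0 <= (W w * \1_(h n @^-1` [set r]) (X w))%:E)%E.
  by move=> W0 w; rewrite lee_fin mulr_ge0.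
under eq_integral do rewrite EFinM.
under [RHS]eq_integral do rewrite EFinM.
have mm (W : T -> R) : measurable_fun setT W ->
    measurable_fun setT (fun w => (W w * \1_(h n @^-1` [set r]) (X w))%:E).
  by move=> mW; apply/measurable_EFinP; apply: measurable_funM => //; exact: m1.
rewrite !ge0_integralZl_EFin//; [|by move=> w _; exact: nn|exact: mm
  |by move=> w _; exact: nn|exact: mm].
by rewrite eqB//; exact: measurable_sfunP.
Qed.

(** Independence is assumed on events only, which is the case where every
    [h i] is an indicator.  The general factors are introduced one at a time:
    with the other factors fixed, their product [W] and the constant [c] equal
    to the product of their expectations integrate every indicator of [X k]
    alike, which is what [integral_mul_comp_unique] asks for. *)
Lemma integral_prod_independent (I : finType) (X : I -> T -> R) :
  (forall i, measurable_fun setT (X i)) ->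
  (forall B : I -> set R, (forall i, measurable (B i)) ->
    P (\bigcap_i (X i @^-1` B i)) = (\prod_i P (X i @^-1` B i))%E) ->
  forall h : I -> R -> R,
  (forall i, measurable_fun setT (h i)) -> (forall i x, 0 <= h i x) ->
  (forall i, P.-integrable setT (EFin \o (h i \o X i))) ->
  (\int[P]_w (\prod_i h i (X i w))%:E = \prod_i \int[P]_w (h i (X i w))%:E)%E.
Proof.
move=> mX indep h mh h0 ih.
(* [K] collects the indices whose factor is not yet an indicator. *)
suff H (n : nat) (K : {set I}) (h' : I -> R -> R) : (#|K| <= n)%N ->
    (forall i, measurable_fun setT (h' i)) -> (forall i x, 0 <= h' i x) ->
    (forall i, P.-integrable setT (EFin \o (h' i \o X i))) ->
    (forall i, i \notin K -> exists2 B, measurable B & h' i = \1_B) ->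
    (\int[P]_w (\prod_i h' i (X i w))%:E = \prod_i \int[P]_w (h' i (X i w))%:E)%E.
  by apply: (H _ [set: I]%SET) => // i; rewrite inE.
elim: n K h' => [|n IHn] K h' Kn {}mh {}h0 {}ih hK.
  have {hK} hB i : exists B, measurable B /\ h' i = \1_B.
    have [|B mB ->] := hK i; last by exists B.
    by move: Kn; rewrite leqn0 cards_eq0 => /eqP ->; rewrite inE.
  have [B /all_and2[mB hE]] := choice hB.
  have mXB i : measurable (X i @^-1` B i) by rewrite -[_ @^-1` _]setTI; exact: mX.
  under [RHS]eq_bigr => i _.
    under eq_integral => w _
      do rewrite hE (_ : \1_(B i) (X i w) = \1_(X i @^-1` B i) w)//.
    rewrite integral_indic// setIT.
    over.
  rewrite -indep// -[in RHS](setIT (\bigcap_i _)) -integral_indic//; last first.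
    by apply: fin_bigcap_measurable => //; exact: finite_finset.
  apply: eq_integral => w _; congr EFin.
  rewrite indicE; case: (boolP (w \in _)) => [|/negP wB].
    rewrite inE => wB; rewrite big1// => i _; rewrite hE indicE mem_set//.
    exact: wB.
  have [i wBi] : exists i, ~ B i (X i w).
    by apply/existsNP => wBi; apply: wB; rewrite inE => i _; exact: wBi.
  by rewrite (bigD1 i)//= hE indicE memNset// mul0r.
have [/eqP|/set0Pn[k kK]] := boolP (K == finset.set0).
  by move=> K0; apply: (IHn K) => //; rewrite K0 cards0.
pose W w := \prod_(i | i != k) h' i (X i w).
pose c := \prod_(i | i != k) fine (\int[P]_w (h' i (X i w))%:E)%E.
have W0 w : 0 <= W w by exact: prodr_ge0.
have c0 : 0 <= c.
  by apply: prodr_ge0 => i _; apply/fine_ge0/integral_ge0 => w _; rewrite lee_fin.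
have mW : measurable_fun setT W.
  rewrite /W; under eq_fun do rewrite -big_filter.
  by apply: measurable_prod => i _; exact: measurableT_comp.
have cE : (\prod_(i | i != k) \int[P]_w (h' i (X i w))%:E = c%:E)%E.
  rewrite /c -prodEFin; apply: eq_bigr => i _; rewrite fineK//.
  exact: integrable_fin_num (ih i).
have intZ (f : T -> R) : measurable_fun setT f -> (forall w, 0 <= f w) ->
    (\int[P]_w (c * f w)%:E = c%:E * \int[P]_w (f w)%:E)%E.
  move=> mf f0; rewrite -ge0_integralZl_EFin//; last exact/measurable_EFinP.
  by move=> w _; rewrite lee_fin.
transitivity (\int[P]_w (W w * h' k (X k w))%:E)%E.
  by apply: eq_integral => w _; rewrite (bigD1 k)//= mulrC.
rewrite (@integral_mul_comp_unique _ _ (X k) W (cst c))//; last first.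
  move=> B mB; pose h'' i := if i == k then \1_B else h' i.
  have h''k i : i != k -> h'' i = h' i by rewrite /h'' => /negPf ->.
  have mXB : measurable (X k @^-1` B) by rewrite -[_ @^-1` _]setTI; exact: mX.
  transitivity (\int[P]_w (\prod_i h'' i (X i w))%:E)%E.
    apply: eq_integral => w _; rewrite [in RHS](bigD1 k)//= {1}/h'' eqxx mulrC.
    by congr (_ * _)%:E; apply: eq_bigr => i ik; rewrite h''k.
  rewrite (IHn (K :\ k)%SET h'')//.
  - rewrite (bigD1 k)//= {1}/h'' eqxx muleC.
    rewrite (eq_bigr (fun i => \int[P]_w (h' i (X i w))%:E)%E); last first.
      by move=> i ik; rewrite h''k.
    by rewrite cE intZ//; exact: measurableT_comp.
  - by rewrite (cardsD1 k) kK in Kn.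
  - by move=> i; rewrite /h''; case: ifP.
  - by move=> i x; rewrite /h''; case: ifP.
  - move=> i; rewrite /h''; case: ifP => // /eqP ->.
    exact: integrable_indic mXB.
  - move=> i; rewrite !inE negb_and negbK /h''.
    case: eqP => [_ _|_ /= iK]; first by exists B.
    exact: hK.
by rewrite (bigD1 k)//= cE muleC intZ//; exact: measurableT_comp.
Qed.

End IndependentProduct.

(** * Bennett's inequality *)

Section Bennett.
Context d (T : measurableType d) (R : realType) (P : probability T R).

(** Integrate [expR_le_bennett] at [y = X w]; the linear term vanishes since [X]
    is centred, and 1 + z <= e^z turns the result into an exponential that
    multiplies well over independent summands. *)
Lemma bennett_mgf (X : T -> R) (s t : R) :
  measurable_fun setT X ->
  P.-integrable setT (EFin \o X) -> (\int[P]_w (X w)%:E = 0)%E ->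
  P.-integrable setT (fun w => (X w ^+ 2)%:E) ->
  (\int[P]_w (X w ^+ 2)%:E <= s%:E)%E ->
  {ae P, forall w, X w <= 1} -> 0 <= t ->
  (\int[P]_w (expR (t * X w))%:E <= (expR ((expR t - 1 - t) * s))%:E)%E.
Proof.
move=> mX iX EX0 iX2 EX2 X1 t0; set c := expR t - 1 - t.
have c0 : 0 <= c by rewrite /c -addrA -opprD subr_ge0 expR_ge1Dx.
pose F w := 1 + t * X w + c * X w ^+ 2.
(* Where [X w <= 1] fails, the quadratic polynomial need not dominate the
   exponential, but its terms are nonnegative. *)
have F0 w : 0 <= F w.
  have [Xw1|/ltW Xw1] := leP (X w) 1.
    exact: le_trans (expR_ge0 _) (expR_le_bennett t0 Xw1).
  by rewrite /F !addr_ge0 ?mulr_ge0 ?sqr_ge0// (le_trans ler01).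
have mexp : measurable_fun setT (fun w => expR (t * X w)).
  by apply: measurableT_comp => //; exact: measurable_funM.
have mF : measurable_fun setT F.
  apply: measurable_funD.
    by apply: measurable_funD => //; exact: measurable_funM.
  by apply: measurable_funM => //; exact: measurable_funX.
apply: (@le_trans _ _ (\int[P]_w (F w)%:E)%E).
  apply: ae_ge0_le_integral => //.
  - exact/measurable_EFinP.
  - by move=> w _; rewrite lee_fin.
  - exact/measurable_EFinP.
  - by apply: filterS X1 => w Xw _; rewrite lee_fin; exact: expR_le_bennett.
have -> : (\int[P]_w (F w)%:E = 1 + c%:E * \int[P]_w (X w ^+ 2)%:E)%E.
  have i1 : P.-integrable setT (EFin \o cst 1%R).
    exact: finite_measure_integrable_cst.
  have i2 : P.-integrable setT (fun w => (t%:E * (X w)%:E)%E).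
    exact: integrableZl.
  have i3 : P.-integrable setT (fun w => (c%:E * (X w ^+ 2)%:E)%E).
    exact: integrableZl.
  transitivity
    (\int[P]_w (1 + t%:E * (X w)%:E + c%:E * (X w ^+ 2)%:E))%E => //.
  rewrite integralD//; last exact: integrableD.
  rewrite integralD//.
  rewrite [X in (_ + X + _)%E](_ : _ = 0)%E; last first.
    by rewrite integralZl// EX0 mule0.
  rewrite integralZl// adde0.
  by congr (_ + _)%E; rewrite integral_cst// mul1e; exact: probability_setT.
apply: (@le_trans _ _ (1 + c%:E * s%:E)%E).
  by rewrite leeD2l// lee_wpmul2l.
by rewrite -EFinM -EFinD lee_fin expR_ge1Dx.
Qed.

(** Chernoff's method: Markov's inequality for e^(t S), factorization of its
    expectation by independence, and [bennett_mgf] for each factor give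
    the bound exp((e^t - 1 - t) sigma2 - t theta).  It is minimal at
    t = ln (1 + theta / sigma2), where it takes the stated value. *)
Lemma bennett (I : finType) (X : I -> T -> R) (sigma2 theta : R) :
  (forall i, measurable_fun setT (X i)) ->
  (forall B : I -> set R, (forall i, measurable (B i)) ->
    P (\bigcap_i (X i @^-1` B i)) = (\prod_i P (X i @^-1` B i))%E) ->
  (forall i, P.-integrable setT (EFin \o X i)) ->
  (forall i, \int[P]_w (X i w)%:E = 0)%E ->
  (forall i, P.-integrable setT (fun w => (X i w ^+ 2)%:E)) ->
  (forall i, {ae P, forall w, X i w <= 1}) ->
  0 < sigma2 -> (\sum_i \int[P]_w (X i w ^+ 2)%:E <= sigma2%:E)%E ->
  0 < theta ->
  (P [set w | (theta <= \sum_i X i w)%R]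
   <= (expR theta * (1 + theta / sigma2) `^ (- (theta + sigma2)))%:E)%E.
Proof.
move=> mX indep iX EX0 iX2 X1 s0 EX2 th0.
set u := 1 + theta / sigma2.
have u1 : 1 < u by rewrite ltrDl divr_gt0.
have u0 : 0 < u by rewrite (lt_trans ltr01).
pose t := ln u.
have t0 : 0 < t by rewrite ln_gt0.
have eS : expR t = u by rewrite lnK.
set c := expR t - 1 - t.
have c0 : 0 <= c by rewrite /c -addrA -opprD subr_ge0 expR_ge1Dx.
pose s i := fine (\int[P]_w (X i w ^+ 2)%:E)%E.
have sE i : (\int[P]_w (X i w ^+ 2)%:E)%E = (s i)%:E.
  by rewrite fineK//; exact: integrable_fin_num (iX2 i).
have mgf i : (\int[P]_w (expR (t * X i w))%:E <= (expR (c * s i))%:E)%E.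
  by apply: bennett_mgf => //; [rewrite sE|exact: ltW].
have mexp i : measurable_fun setT (fun w => expR (t * X i w)).
  by apply: measurableT_comp => //; exact: measurable_funM.
have iexp i : P.-integrable setT (EFin \o ((fun x => expR (t * x)) \o X i)).
  apply/integrableP; split; first by apply/measurable_EFinP; exact: mexp.
  apply: le_lt_trans (ltry (expR (c * s i))).
  under eq_integral do rewrite gee0_abs ?lee_fin ?expR_ge0//.
  exact: mgf.
pose S : T -> R := fun w => \sum_i X i w.
have mS : measurable_fun setT S by exact: measurable_sum.
pose Srv : {RV P >-> R} := mfun_Sub (mem_set mS).
have := @chernoff _ _ _ P Srv t theta t0.
rewrite [X in (P X <= _)%E -> _](_ : _ = [set w | (theta <= S w)%R])//.
move=> /le_trans; apply.
have -> : ('M_P Srv t = \prod_i \int[P]_w (expR (t * X i w))%:E)%E.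
  rewrite -(@integral_prod_independent _ _ _ P _ X mX indep
    (fun _ x => expR (t * x)))//.
    rewrite /mmt_gen_fun unlock; apply: eq_integral => w _ /=.
    by rewrite mulrC /S mulr_sumr expR_sum.
  by move=> i; apply: measurableT_comp => //; exact: measurable_funM.
apply: (@le_trans _ _
  ((\prod_i (expR (c * s i))%:E) * (expR (- (t * theta)))%:E)%E).
  apply: lee_wpmul2r; first by rewrite lee_fin expR_ge0.
  suff /andP[] : (0 <= \prod_i \int[P]_w (expR (t * X i w))%:E
      <= \prod_i (expR (c * s i))%:E)%E by [].
  apply: (big_ind2 (fun x y => 0 <= x <= y)%E) => [|x1 y1 x2 y2|i _].
  - by rewrite lee_fin ler01 lexx.
  - by move=> /andP[x10 xy1] /andP[x20 xy2]; rewrite mule_ge0//= lee_pmul.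
  - by rewrite mgf integral_ge0// => w _; rewrite lee_fin expR_ge0.
rewrite prodEFin -expR_sum -mulr_sumr -EFinM -expRD lee_fin.
rewrite /powR gt_eqF// -expRD ler_expR.
have sumle : \sum_i s i <= sigma2.
  by rewrite -lee_fin -sumEFin; under eq_bigr do rewrite -sE.
apply: (@le_trans _ _ (c * sigma2 - t * theta)).
  by rewrite lerD2r ler_wpM2l.
rewrite le_eqVlt; apply/orP; left; apply/eqP.
rewrite /c eS -/t /u.
by field; exact: lt0r_neq0.
Qed.

End Bennett.

(** * Real symmetric matrices *)

Lemma char_poly_conj (F : comUnitRingType) n (P D : 'M[F]_n) : P \in unitmx ->
  char_poly (invmx P *m D *m P) = char_poly D.
Proof.
move=> uP; rewrite /char_poly.
have PV : map_mx (@polyC F) (invmx P) *m map_mx (@polyC F) P = 1%:M.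
  by rewrite -map_mxM mulVmx// map_mx1.
have -> : char_poly_mx (invmx P *m D *m P) =
    map_mx (@polyC F) (invmx P) *m char_poly_mx D *m map_mx (@polyC F) P.
  rewrite /char_poly_mx mulmxBr mulmxBl !map_mxM; congr (_ - _).
  by rewrite scalar_mxC -mulmxA PV mulmx1.
by rewrite !det_mulmx mulrAC -det_mulmx PV det1 mul1r.
Qed.

Section RealSpectralTheorem.
Variable R : rcfType.
Local Notation toC := (real_complex R).
Local Open Scope sesquilinear_scope.

(** The spectral theorem over R[i], brought back to R: a real symmetric matrix
    is Hermitian, hence unitarily diagonalizable with real eigenvalues [D].
    The unitary matrix need not be real, so only the two facts about [D] that
    do not mention it are kept: the factorization of the characteristic
    polynomial, and the bound on the quadratic form, which in the eigenbasis
    is the sum of the D_i |y_i|^2 while the squared norm is that of the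
    |y_i|^2. *)
Lemma symmetric_spectral n (A : 'M[R]_n) : A^T = A ->
  exists D : 'rV[R]_n,
    char_poly A = \prod_i ('X - (D 0 i)%:P) /\
    (forall (c : R) (x : 'rV[R]_n), (forall i, D 0 i <= c) ->
      (x *m A *m x^T) 0 0 <= c * (x *m x^T) 0 0).
Proof.
move=> symA; pose B := map_mx toC A.
have hB : B \is hermsymmx.
  apply: realsym_hermsym.
    apply/is_hermitianmxP; rewrite expr0 scale1r map_mx_id// /B.
    by rewrite -[in LHS]symA map_trmx.
  by apply/mxOverP => i j; rewrite mxE; apply/complex_realP; exists (A i j).
pose P := spectralmx B; pose E := spectral_diag B.
have uP : P \is unitarymx := spectral_unitarymx B.
have BE : B = invmx P *m diag_mx E *m P.
  exact/orthomx_spectralP/hermitian_normalmx.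
pose D : 'rV[R]_n := \row_i complex.Re (E 0 i).
have ED : E = map_mx toC D.
  apply/rowP => i; rewrite !mxE.
  have /mxOverP/(_ 0 i) := hermitian_spectral_diag_real hB.
  by move/RRe_real => ->.
exists D; split.
  apply: (map_poly_inj toC).
  rewrite map_char_poly -/B BE char_poly_conj; last first.
    exact: unitarymx_unit.
  rewrite char_poly_trig ?diag_mx_is_trig// rmorph_prod; apply: eq_bigr => i _.
  by rewrite ED !mxE eqxx mulr1n rmorphB/= map_polyX map_polyC.
move=> c x Dc; pose X := map_mx toC x.
have [y yE] : exists y, y = X *m P^t* by exists (X *m P^t*).
have XT : X^t* = map_mx toC x^T.
  apply/matrixP => i j; rewrite !mxE; apply: conj_Creal.
  by apply/complex_realP; exists (x j i).
have yT : y^t* = P *m X^t* by rewrite yE trmx_mul map_mxM trmxCK.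
have normE (z : R[i]) : toC (complex.Re (`|z| ^+ 2)) = z * z^*.
  by rewrite RRe_real ?rpredX ?normr_real// normCK.
have -> : (x *m A *m x^T) 0 0 = \sum_i D 0 i * complex.Re (`|y 0 i| ^+ 2).
  apply: (@complexI R).
  transitivity ((X *m B *m X^t*) 0 0); first by rewrite XT -!map_mxM [RHS]mxE.
  rewrite BE invmx_unitary// -!mulmxA -yT !mulmxA -yE [LHS]mxE rmorph_sum.
  apply: eq_bigr => i _; rewrite mul_mx_diag.
  transitivity (toC (D 0 i) * toC (complex.Re (`|y 0 i| ^+ 2))); last first.
    by rewrite -rmorphM.
  rewrite normE.
  have -> : toC (D 0 i) = E 0 i by rewrite [in RHS]ED [RHS]mxE.
  by rewrite !mxE mulrAC mulrC.
have -> : (x *m x^T) 0 0 = \sum_i complex.Re (`|y 0 i| ^+ 2).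
  apply: (@complexI R).
  transitivity ((X *m X^t*) 0 0); first by rewrite XT -!map_mxM [RHS]mxE.
  have -> : X *m X^t* = y *m y^t*.
    rewrite yT yE -!mulmxA [P^t* *m _]mulmxA -invmx_unitary//.
    by rewrite mulVmx ?unitarymx_unit// mul1mx.
  rewrite [LHS]mxE rmorph_sum; apply: eq_bigr => i _.
  by transitivity (y 0 i * (y 0 i)^*); [rewrite !mxE|rewrite -normE].
rewrite mulr_sumr; apply: ler_sum => i _; apply: ler_wpM2r => //.
have : 0 <= `|y 0 i| ^+ 2 by rewrite exprn_ge0.
by rewrite lecE => /andP[].
Qed.

End RealSpectralTheorem.

(** * Quadratic forms and eigenvalues of Hermitian tensors *)

Section TensorAlgebra.
Variables (R : realType) (m M : nat).
Implicit Types (X Y Z : tensor1 R m M) (L K : tensor2 R m M).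

Lemma tinnerC X Y : tinner X Y = tinner Y X.
Proof. by apply: eq_bigr => i _; rewrite mulrC. Qed.

Lemma tinner_ge0 X : 0 <= tinner X X.
Proof. by apply: sumr_ge0 => i _; rewrite -expr2 sqr_ge0. Qed.

Lemma tinner_eq0 X : tinner X X = 0 -> X = 0.
Proof.
move=> XX0; apply/ffunP => i; rewrite ffunE; apply/eqP; rewrite -sqrf_eq0.
have /psumr_eq0P XX : forall i : mindex m M, true -> 0 <= X i * X i.
  by move=> j _; rewrite -expr2 sqr_ge0.
by rewrite expr2 XX.
Qed.

Lemma tinnerZl (a : R) X Y : tinner (a *: X) Y = a * tinner X Y.
Proof.
by rewrite /tinner mulr_sumr; apply: eq_bigr => i _; rewrite !ffunE mulrA.
Qed.

Lemma tinnerZr (a : R) X Y : tinner X (a *: Y) = a * tinner X Y.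
Proof. by rewrite tinnerC tinnerZl tinnerC. Qed.

Lemma tinnerBl X Y Z : tinner (X - Y) Z = tinner X Z - tinner Y Z.
Proof.
by rewrite /tinner -sumrB; apply: eq_bigr => i _; rewrite !ffunE mulrBl.
Qed.

Lemma tinner_tapplyE X L Y :
  tinner X (tapply L Y) = \sum_p L p * (X p.1 * Y p.2).
Proof.
rewrite /tinner (eq_bigr (fun i => \sum_j L (i, j) * (X i * Y j))).
  by rewrite pair_big; apply: eq_bigr => -[].
move=> i _; rewrite ffunE mulr_sumr; apply: eq_bigr => j _.
by rewrite mulrCA.
Qed.

Lemma tinner_tapply_sum (N : nat) X (L : 'I_N -> tensor2 R m M) Y :
  tinner X (tapply (\sum_(i < N) L i) Y) =
  \sum_(i < N) tinner X (tapply (L i) Y).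
Proof.
rewrite tinner_tapplyE; under [RHS]eq_bigr do rewrite tinner_tapplyE.
rewrite exchange_big; apply: eq_bigr => p _ /=.
by rewrite sum_ffunE mulr_suml.
Qed.

Lemma thermitian_adjoint X L Y : thermitian L ->
  tinner X (tapply L Y) = tinner (tapply L X) Y.
Proof.
move=> hL; rewrite [RHS]tinnerC !tinner_tapplyE.
rewrite (reindex_inj (h := fun p => (p.2, p.1)))/=; last by move=> [? ?] [? ?] [-> ->].
by apply: eq_bigr => -[i j] _ /=; rewrite hL [X _ * _]mulrC.
Qed.

Lemma tapply_tmul L K X : tapply (tmul L K) X = tapply L (tapply K X).
Proof.
apply/ffunP => i; rewrite !ffunE.
under eq_bigr do rewrite ffunE mulr_suml.
rewrite exchange_big; apply: eq_bigr => j _ /=.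
by rewrite ffunE mulr_sumr; apply: eq_bigr => k _; rewrite mulrA.
Qed.

(** Cauchy-Schwarz for a unit tensor [X], from the nonnegativity of the squared
    norm of the component of [Z] orthogonal to [X]. *)
Lemma tinner_sqr_le X Z : tinner X X = 1 -> tinner X Z ^+ 2 <= tinner Z Z.
Proof.
move=> X1; rewrite -subr_ge0; set a := tinner X Z.
have <- : tinner (Z - a *: X) (Z - a *: X) = tinner Z Z - a ^+ 2.
  rewrite tinnerBl tinnerZl (tinnerC Z (Z - _)) (tinnerC X (Z - _)).
  by rewrite !tinnerBl !tinnerZl X1 (tinnerC Z X) -/a; ring.
exact: tinner_ge0.
Qed.

Lemma thermitian_sum (N : nat) (L : 'I_N -> tensor2 R m M) :
  (forall i, thermitian (L i)) -> thermitian (\sum_(i < N) L i).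
Proof.
by move=> hL i j; rewrite !sum_ffunE; apply: eq_bigr => k _; exact: hL.
Qed.

Lemma thermitian_tmul L : thermitian L -> thermitian (tmul L L).
Proof.
move=> hL i j; rewrite !ffunE; apply: eq_bigr => k _ /=.
by rewrite mulrC (hL i k) (hL k j).
Qed.

End TensorAlgebra.

Lemma sum_enum_val (V : nmodType) (T : finType) (F : T -> V) :
  \sum_i F i = \sum_(a < #|{: T}|) F (enum_val a).
Proof. by rewrite (reindex _ (onW_bij _ (enum_val_bij T))). Qed.

Section Eigenvalues.
Variables (R : realType) (m M : nat).
Implicit Types (X Y : tensor1 R m M) (L K : tensor2 R m M).

Lemma unfolding_sym L : thermitian L -> (unfolding L)^T = unfolding L.
Proof. by move=> hL; apply/matrixP => a b; rewrite !mxE. Qed.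

(** By [symmetric_spectral] the characteristic polynomial of the unfolding
    splits, so [eigenvalues L] is a sorted list of all its roots instead of the
    default empty list, and its head bounds every diagonal entry [D 0 i]. *)
Lemma rayleigh_le_lambda_max L X : thermitian L ->
  tinner X (tapply L X) <= lambda_max L * tinner X X.
Proof.
move=> hL; have [D [chD rayD]] := symmetric_spectral (unfolding_sym hL).
have : [set s : seq R | sorted >=%O s /\
    char_poly (unfolding L) = \prod_(x <- s) ('X - x%:P)] (eigenvalues L).
  apply: xgetPex.
  exists (sort >=%O [seq D 0 i | i <- enum 'I_(#|{: mindex m M}|)]).
  split; first by apply: sort_sorted => x y; exact: le_total.
  rewrite chD (perm_big _ (permEl (perm_sort _ _)))/= big_map big_enum.
  by [].
move=> [sorted_s chs].
have D_le i : D 0 i <= lambda_max L.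
  have : root (\prod_(x <- eigenvalues L) ('X - x%:P)) (D 0 i).
    rewrite -chs chD; apply/rootP.
    by rewrite horner_prod (bigD1 i)//= !hornerE subrr mul0r.
  rewrite root_prod_XsubC => Ds; rewrite /lambda_max /lambda /=.
  have isz : (index (D 0%R i) (eigenvalues L) < size (eigenvalues L))%N.
    by rewrite index_mem.
  rewrite -[leLHS](nth_index 0 Ds).
  apply: (sorted_leq_nth (leT := >=%O)) => //.
  - by move=> x y z /= yx zy; exact: le_trans zy yx.
  - by move=> x /=.
  - by rewrite inE (leq_ltn_trans _ isz).
pose x : 'rV[R]_#|{: mindex m M}| := \row_a X (enum_val a).
have := rayD _ x D_le; congr (_ <= _ * _).
  rewrite mxE /tinner [RHS]sum_enum_val; apply: eq_bigr => a _.
  rewrite !mxE ffunE [in RHS]sum_enum_val mulrC.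
  congr (_ * _); apply: eq_bigr => b _; rewrite !mxE mulrC.
  by rewrite hL.
by rewrite mxE /tinner [RHS]sum_enum_val; apply: eq_bigr => a _; rewrite !mxE.
Qed.

(** Positivity of [lambda k K] excludes both default values: the empty list
    of eigenvalues and an index beyond its end.  What remains is a genuine root
    of the characteristic polynomial. *)
Lemma lambda_eigentensor k K : thermitian K -> 0 < lambda k K ->
  exists X, tinner X X = 1 /\ tapply K X = lambda k K *: X.
Proof.
move=> hK l0; set l := lambda k K.
have chs : char_poly (unfolding K) = \prod_(x <- eigenvalues K) ('X - x%:P).
  move: l0; rewrite /lambda /eigenvalues.
  by case: xgetP => [s _ []//|_]; rewrite nth_nil ltxx.
have : eigenvalue (unfolding K) l.
  rewrite eigenvalue_root_char chs root_prod_XsubC /l /lambda mem_nth// ltnNge.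
  by apply/negP => sk; move: l0; rewrite /lambda nth_default// ltxx.
move=> /eigenvalueP[v vK v0].
pose X : tensor1 R m M := [ffun i => v 0 (enum_rank i)].
have KX : tapply K X = l *: X.
  apply/ffunP => i; rewrite !ffunE.
  transitivity (l * v 0 (enum_rank i)); last by [].
  (* [v] is a row eigenvector; the symmetry of [K] turns it into a column. *)
  have /rowP/(_ (enum_rank i)) := vK; rewrite !mxE => <-.
  rewrite sum_enum_val.
  apply: eq_bigr => a _; rewrite !mxE ffunE enum_valK enum_rankK mulrC.
  by rewrite hK.
have X0 : 0 < tinner X X.
  rewrite lt_neqAle tinner_ge0 andbT eq_sym; apply/eqP => /tinner_eq0 X0.
  move: v0; apply/negP; rewrite negbK; apply/eqP/rowP => a.
  by have /ffunP/(_ (enum_val a)) := X0; rewrite !ffunE enum_valK mxE.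
pose r := Num.sqrt (tinner X X).
have r0 : r != 0 by rewrite gt_eqF ?sqrtr_gt0.
exists (r^-1 *: X); split.
  rewrite tinnerZl tinnerZr mulrA -invfM -expr2 sqr_sqrtr ?(ltW X0)// mulVf//.
  exact: lt0r_neq0.
apply/ffunP => i; have /ffunP/(_ i) := KX; rewrite !ffunE => KXi.
under eq_bigr do rewrite ffunE mulrCA.
by rewrite -mulr_sumr KXi mulrCA.
Qed.

End Eigenvalues.

(** * Quadratic forms of random tensors *)

Section TensorMeasurability.
Variables (R : realType) (m M : nat).

Lemma measurable_tinner_tapply d (T : measurableType d)
    (L : T -> tensor2 R m M) (X Y : tensor1 R m M) :
  (forall p, measurable_fun setT (fun w => L w p : R)) ->
  measurable_fun setT (fun w => tinner X (tapply (L w) Y)).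
Proof.
move=> mL; under eq_fun do rewrite tinner_tapplyE.
by apply: measurable_sum => p; apply: measurable_funM => //; exact: mL.
Qed.

Lemma integral_tinner_tapply d (T : measurableType d) (P : probability T R)
    (L : T -> tensor2 R m M) (X Y : tensor1 R m M) : tintegrable P L ->
  P.-integrable setT (fun w => (tinner X (tapply (L w) Y))%:E) /\
  (\int[P]_w (tinner X (tapply (L w) Y))%:E =
   (tinner X (tapply (texpectation P L) Y))%:E)%E.
Proof.
move=> iL; pose c (p : mindex m M * mindex m M) : R := X p.1 * Y p.2.
have sumE w :
    (tinner X (tapply (L w) Y))%:E = (\sum_p (c p)%:E * (L w p : R)%:E)%E.
  rewrite tinner_tapplyE -sumEFin; apply: eq_bigr => p _.
  by rewrite mulrC EFinM.
have icL p : P.-integrable setT (fun w => ((c p)%:E * (L w p : R)%:E)%E).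
  by apply: integrableZl => //; exact: iL.
split; first by under eq_fun do rewrite sumE; exact: integrable_sum.
under eq_integral do rewrite sumE.
rewrite integral_sum// tinner_tapplyE -sumEFin; apply: eq_bigr => p _.
rewrite (integralZl measurableT (iL p)).
rewrite ffunE muleC [RHS]EFinM; congr (_ * _)%E.
by rewrite unlock fineK//; exact: integrable_fin_num (iL p).
Qed.

(** Any subset [S] of a finite-dimensional space is separable: for each
    rational point and each [n], choose a point of [S] within distance
    1 / (n + 1) of that rational point, if there is one.  In this form the lemma applies to the unit
    sphere of a subspace without a parametrization of it. *)
Lemma countable_dense_subset (I : finType) (S : set {ffun I -> R^o})
    (X0 : {ffun I -> R^o}) :
  S X0 -> exists p : {ffun I -> rat} * nat -> {ffun I -> R^o},
    (forall j, S (p j)) /\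
    (forall X, S X -> exists q : nat -> {ffun I -> rat},
      forall i, p (q n, n) i @[n --> \oo] --> (X i : R)).
Proof.
move=> SX0.
pose near_q (j : {ffun I -> rat} * nat) : set {ffun I -> R^o} :=
  [set X | S X /\ forall i, `|(X i : R) - ratr (j.1 i)| < j.2.+1%:R^-1].
exists (fun j => xget X0 (near_q j)); split.
  by move=> j; case: xgetP => [x -> []|].
move=> X SX.
have qP n (x : R) : exists q : rat, `|x - ratr q| < n.+1%:R^-1.
  set e : R := n.+1%:R^-1; have e0 : 0 < e by rewrite invr_gt0.
  have lt_e : x - e < x + e by lra.
  have [q] := rat_in_itvoo lt_e; rewrite in_itv/= => /andP[q1 q2].
  by exists q; rewrite ltr_norml; apply/andP; split; lra.
pose q n : {ffun I -> rat} := [ffun i => projT1 (cid (qP n (X i)))].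
exists q => i; apply/cvgrPdist_le => /= e e0.
have near_X n : near_q (q n, n) X.
  by split=> // k /=; rewrite ffunE; exact: (projT2 (cid (qP n (X k)))).
have e2 : 0 < e / 2 by rewrite divr_gt0.
near=> n.
have [_ /(_ i) /= close_p] :=
  @xgetPex _ X0 (near_q (q n, n)) (ex_intro _ X (near_X n)).
have [_ /(_ i) /= close_X] := near_X n.
set Y := xget _ _ in close_p *.
have n_small : n.+1%:R^-1 < e / 2.
  by near: n; exact: (near_infty_natSinv_lt (PosNum e2)).
have -> : (X i : R) - Y i = (X i - ratr (q n i)) - (Y i - ratr (q n i)).
  by rewrite opprB addrA subrK.
rewrite (le_trans (ler_normB _ _))// (splitr e) lerD// (le_trans (ltW _) (ltW n_small))//.
Unshelve. all: by end_near. Qed.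

(** An uncountable intersection of events; by continuity of the quadratic form,
    it may be restricted to a countable dense subset of [S]. *)
Lemma measurable_forall_quadratic_ge d (T : measurableType d)
    (L : T -> tensor2 R m M) (S : set (tensor1 R m M)) (theta : R) :
  (forall p, measurable_fun setT (fun w => L w p : R)) ->
  measurable [set w | forall X, S X -> theta <= tinner X (tapply (L w) X)].
Proof.
move=> mL; have [[X0 SX0]|noS] := pselect (exists X, S X); last first.
  rewrite (_ : [set w | _] = setT)//; apply/seteqP; split=> // w _ X SX.
  by exfalso; apply: noS; exists X.
have [p [Sp densep]] := countable_dense_subset SX0.
pose E j := [set w | theta <= tinner (p j) (tapply (L w) (p j))].
have mE j : measurable (E j).
  rewrite -[E j]setTI; apply: measurable_fun_le => //.
  exact: measurable_tinner_tapply.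
rewrite (_ : [set w | _] = ~` \bigcup_j ~` E j).
  apply/measurableC/countable_bigcupT_measurable => // j.
  exact: measurableC.
rewrite setC_bigcup; apply/seteqP; split=> [w Hw j _|w Hw X SX].
  by rewrite setCK; exact: Hw.
have [q qX] := densep _ SX.
have cvgq : tinner (p (q n, n)) (tapply (L w) (p (q n, n))) @[n --> \oo] -->
    tinner X (tapply (L w) X).
  rewrite tinner_tapplyE; under eq_fun do rewrite tinner_tapplyE.
  apply: cvg_big => [|k _]; first exact: add_continuous.
  by apply: cvgM; [exact: cvg_cst|apply: cvgM; exact: qX].
rewrite -(cvg_lim _ cvgq)//; apply: limr_ge.
  by apply/cvg_ex; exists (tinner X (tapply (L w) X)).
by apply: nearW => n; have := Hw (q n, n) I; rewrite setCK.
Qed.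

End TensorMeasurability.

(** * Laplacians of random hypergraphs *)

Section HypergraphLaplacian.
Context d (T : measurableType d) (R : realType) (P : probability T R).
Variables m M : nat.
Implicit Type G : random_hypergraph P m M.

Lemma hedges_uniq G (i j : mindex m M) :
  (vertices i, vertices j) \in hedges G -> uniq i /\ uniq j.
Proof.
move=> /hedges_uniform[ci cj _].
have uniq_of_card (k : mindex m M) : #|vertices k| = M -> uniq k.
  by move=> ck; apply/card_uniqP; rewrite size_tuple -[RHS]ck cardsE.
by split; apply: uniq_of_card.
Qed.

Lemma tapply_is_linear (L : tensor2 R m M) : linear (tapply L).
Proof.
move=> a X Y; apply/ffunP => i; rewrite !ffunE scaler_sumr -big_split.
apply: eq_bigr => j _ /=; rewrite !ffunE mulrDr; congr (_ + _).
by rewrite mulrCA.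
Qed.

HB.instance Definition _ (L : tensor2 R m M) :=
  GRing.isLinear.Build R (tensor1 R m M) (tensor1 R m M) _ (tapply L)
    (tapply_is_linear L).

(** Rows of the Laplacian sum to zero, since the degree is the row sum of the
    adjacency tensor; and columns at a tuple with a repeated index vanish,
    since such a tuple is never a source or a destination. *)
Lemma laplacian_trivial G w Y : Y \in trivial_space R m M ->
  tapply (laplacian G w) Y = 0.
Proof.
move=> /memv_addP[_ /vlineP[a ->] [_ /memv_sumP[Z /= ZP ->] ->]].
rewrite linearD linearZ linear_sum /= big1 => [|i nui]; last first.
  have /vlineP[c ->] := ZP i nui.
  rewrite linearZ/= [tapply _ _](_ : _ = 0) ?scaler0//.
  apply/ffunP => k; rewrite [RHS]ffunE; transitivity (laplacian G w (k, i) : R).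
    rewrite ffunE (bigD1 i)//= [X in _ * X]ffunE eqxx mulr1 big1 ?addr0// => j ji.
    by rewrite [X in _ * X]ffunE (negPf ji) mulr0.
  have notin_hedges j l : ~~ uniq (tval j) \/ ~~ uniq (tval l) ->
      adjacency G w (j, l) = 0.
    move=> nu; rewrite ffunE; case: ifP => // /hedges_uniq[uj ul].
    by case: nu; rewrite ?uj ?ul.
  rewrite !ffunE/=; case: eqP => [->|_].
    rewrite big1 => [|j _]; last by apply: notin_hedges; left.
    have := notin_hedges i i (or_introl nui); rewrite ffunE /= => ->.
    by rewrite subr0.
  have := notin_hedges k i (or_intror nui); rewrite ffunE /= => ->.
  by rewrite subr0.
rewrite addr0 [tapply _ _](_ : _ = 0) ?scaler0//.
apply/ffunP => k; rewrite [RHS]ffunE ffunE.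
transitivity (\sum_j (degree G w (k, j) - adjacency G w (k, j) : R)).
  by apply: eq_bigr => j _; rewrite [X in _ * X]ffunE mulr1 !ffunE.
rewrite sumrB; apply/eqP; rewrite subr_eq0; apply/eqP.
rewrite (bigD1 k)//= big1 => [|j jk]; first by rewrite addr0 ffunE /= eqxx.
by rewrite ffunE /= eq_sym (negPf jk).
Qed.

(** The generators of [hypergraph_sigma_algebra G]. *)
Definition weight_events G : set_system T :=
  [set A | exists2 e, e \in hedges G &
     exists2 B : set R, measurable B & A = rweight G e @^-1` B].

(** Measurability is needed for the sub-sigma-algebra generated by the weights,
    because this is where the independence of hypergraphs is expressed; the
    sample space is therefore given the corresponding measurable structure. *)
Lemma measurable_laplacian G p :
  measurable_fun setT
    ((fun w => laplacian G w p) : g_sigma_algebraType (weight_events G) -> R).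
Proof.
have madj q : measurable_fun setT
    ((fun w => adjacency G w q) : g_sigma_algebraType (weight_events G) -> R).
  have [he|/negPf he] := boolP ((vertices q.1, vertices q.2) \in hedges G).
    have -> : (fun w => adjacency G w q : R) =
        rweight G (vertices q.1, vertices q.2).
      by apply/funext => w; rewrite ffunE he.
    move=> _ B mB; rewrite setTI; apply: sub_sigma_algebra.
    by exists (vertices q.1, vertices q.2) => //; exists B.
  have -> : (fun w => adjacency G w q : R) = cst 0.
    by apply/funext => w; rewrite ffunE he.
  exact: measurable_cst.
have -> : (fun w => laplacian G w p : R) =
    (fun w => (if p.1 == p.2 then \sum_j adjacency G w (p.1, j) else 0)
              - adjacency G w p).
  by apply/funext => w; rewrite !ffunE.
apply: measurable_funB; last exact: madj.
case: eqP => _; last exact: measurable_cst.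
by apply: measurable_sum => j; exact: madj.
Qed.

Lemma hypergraph_sigma_algebra_measurable G (A : set T) :
  hypergraph_sigma_algebra G A -> measurable A.
Proof.
apply: smallest_sub; first exact: sigma_algebra_measurable.
by move=> _ [e he [B mB ->]]; rewrite -[_ @^-1` _]setTI; exact: measurable_funP.
Qed.

Lemma hypergraph_sigma_algebra_quadratic G (X Y : tensor1 R m M) (B : set R) :
  measurable B ->
  hypergraph_sigma_algebra G
    ((fun w => tinner X (tapply (laplacian G w) Y)) @^-1` B).
Proof.
move=> mB.
have mq := @measurable_tinner_tapply R m M _ (g_sigma_algebraType (weight_events G))
  (laplacian G) X Y (@measurable_laplacian G).
have := mq measurableT B mB; rewrite setTI; exact.
Qed.

End HypergraphLaplacian.

(** * Tail bound for the algebraic connectivity *)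

Lemma ffact_le_expn n k : (n ^_ k <= n ^ k)%N.
Proof.
elim: k => [|k IHk]; first by rewrite ffactn0.
by rewrite ffactnSr expnSr leq_mul// leq_subr.
Qed.

Section AlgebraicConnectivity.
Variables (R : realType) (m M : nat).
Implicit Types (X : tensor1 R m M) (L : tensor2 R m M).

Definition connectivity_domain : set (tensor1 R m M) :=
  [set X | frobenius X = 1 /\
     forall Y, Y \in trivial_space R m M -> tinner X Y = 0].

(** Since [theta > 0] and [inf] takes the value 0 on sets without infimum, the
    left-hand side already forces the set of values of the quadratic form to be
    bounded below.  The tensor [X] witnesses that this set is nonempty. *)
Lemma le_algebraic_connectivity L X (theta : R) : 0 < theta ->
  connectivity_domain X ->
  theta <= algebraic_connectivity L <->
  (forall Z, connectivity_domain Z -> theta <= tinner Z (tapply L Z)).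
Proof.
move=> theta0 domX; rewrite /algebraic_connectivity; set S := (Q in inf Q).
have SX Z : connectivity_domain Z -> S (tinner Z (tapply L Z)).
  by move=> [Z1 Zperp]; exists Z.
split=> [le_inf Z /SX SZ|leL]; last first.
  apply: lb_le_inf; first by exists (tinner X (tapply L X)); exact: SX.
  by move=> _ [Z [Z1 Zperp ->]]; exact: leL.
have [_ lbS] : has_inf S.
  by apply: contrapT => /inf_out S0; move: le_inf; rewrite S0 leNgt theta0.
exact: le_trans le_inf (ge_inf lbS SZ).
Qed.

End AlgebraicConnectivity.

Theorem theorem5 (d : measure_display) (T : measurableType d) (R : realType)
    (P : probability T R) (m M N : nat)
    (hM : (1 <= M)%N) (hm : (M < m)%N)
    (G : 'I_N -> random_hypergraph P m M)
    (Gindep : independent_hypergraphs G)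
    (Lherm : forall (i : 'I_N) (w : T), thermitian (laplacian (G i) w))
    (Lint : forall i : 'I_N, tintegrable P (laplacian (G i)))
    (Lmean : forall i : 'I_N, texpectation P (laplacian (G i)) = 0)
    (L2int : forall i : 'I_N, tintegrable P (tsquare (laplacian (G i))))
    (Lmax : forall i : 'I_N,
      {ae P, forall w, lambda_max (laplacian (G i) w) <= 1})
    (sigma2_gt0 : 0 < ensemble_sigma2 G)
    (theta : R) (theta_gt0 : 0 < theta) :
  (P [set w | (theta <= algebraic_connectivity (ensemble_laplacian G w))%R]
   <= (((m ^ M)%:R - (m`! %/ (m - M)`!)%:R + 2)
       * expR theta
       * (1 + theta / ensemble_sigma2 G)
           `^ (- (theta + ensemble_sigma2 G)))%:E)%E.
Proof.
pose L i := laplacian (G i).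
set s2 := ensemble_sigma2 G in sigma2_gt0 *.
pose K := \sum_(i < N) texpectation P (tsquare (L i)).
have hermK : thermitian K.
  apply: thermitian_sum => i a b; rewrite !ffunE; congr (fine _).
  congr expectation; apply/funext => w.
  exact: (thermitian_tmul (Lherm i w)).
(* The unit direction in which the connectivity is tested. *)
have [X [X1 KX]] := lambda_eigentensor hermK sigma2_gt0.
have tsquareE i w Y : tinner Y (tapply (tsquare (L i) w) X) =
    tinner (tapply (L i w) Y) (tapply (L i w) X).
  by rewrite tapply_tmul thermitian_adjoint//; exact: Lherm.
have quadK Y : (tinner Y (tapply K X))%:E =
    (\sum_(i < N) \int[P]_w (tinner (tapply (L i w) Y) (tapply (L i w) X))%:E)%E.
  rewrite tinner_tapply_sum -sumEFin; apply: eq_bigr => i _.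
  rewrite -(integral_tinner_tapply Y X (L2int i)).2.
  by apply: eq_integral => w _; rewrite tsquareE.
(* [K] maps into the orthogonal complement of the trivial space, and [K X] is a
   nonzero multiple of [X]. *)
have domX : connectivity_domain X.
  split=> [|Y Ytriv]; first by rewrite /frobenius X1 sqrtr1.
  have : (tinner Y (tapply K X))%:E = 0%E.
    rewrite quadK big1// => i _; apply: integral0_eq => w _.
    rewrite laplacian_trivial//.
    by rewrite /tinner big1// => j _; rewrite ffunE mul0r.
  move=> [] /eqP; rewrite KX tinnerZr mulf_eq0 gt_eqF//= => /eqP YX.
  by rewrite tinnerC.
pose q i w := tinner X (tapply (L i w) X).
have mq i : measurable_fun setT (q i).
  move=> _ B mB; rewrite setTI; apply: hypergraph_sigma_algebra_measurable.
  exact: hypergraph_sigma_algebra_quadratic.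
have q_indep (B : 'I_N -> set R) : (forall i, measurable (B i)) ->
    P (\bigcap_i (q i @^-1` B i)) = (\prod_i P (q i @^-1` B i))%E.
  move=> mB; have := Gindep [set: 'I_N]%SET (fun i => q i @^-1` B i).
  rewrite (_ : [set` [set: 'I_N]%SET] = setT); last first.
    by apply/seteqP; split=> // i _ /=; rewrite inE.
  move=> ->; first by apply: eq_bigl => i; rewrite inE.
  by move=> i _; exact: hypergraph_sigma_algebra_quadratic.
have [q_int q_mean] : (forall i, P.-integrable setT (EFin \o q i)) /\
    (forall i, \int[P]_w (q i w)%:E = 0)%E.
  split=> i; have [iq Eq] := integral_tinner_tapply X X (Lint i); first exact: iq.
  by rewrite Eq Lmean tinner_tapplyE big1// => p _; rewrite ffunE mul0r.
have q2_le i w : q i w ^+ 2 <= tinner (tapply (L i w) X) (tapply (L i w) X).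
  exact: tinner_sqr_le.
have L2X_int i : P.-integrable setT
    (fun w => (tinner (tapply (L i w) X) (tapply (L i w) X))%:E).
  have [iq _] := integral_tinner_tapply X X (L2int i).
  by apply: eq_integrable iq => // w _; rewrite tsquareE.
have mq2 i : measurable_fun setT (fun w => (q i w ^+ 2)%:E).
  by apply/measurable_EFinP; exact: measurable_funX.
have q2_int i : P.-integrable setT (fun w => (q i w ^+ 2)%:E).
  apply: le_integrable (L2X_int i) => // w _ /=.
  by rewrite lee_fin !ger0_norm ?tinner_ge0 ?sqr_ge0.
have q_le1 i : {ae P, forall w, q i w <= 1}.
  apply: filterS (Lmax i) => w Lw1.
  apply: le_trans (rayleigh_le_lambda_max X (Lherm i w)) _.
  by rewrite X1 mulr1.
have q_var : (\sum_i \int[P]_w (q i w ^+ 2)%:E <= s2%:E)%E.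
  have -> : s2%:E = (tinner X (tapply K X))%:E by rewrite KX tinnerZr X1 mulr1.
  rewrite quadK; apply: lee_sum => i _.
  apply: ge0_le_integral => //.
  - by move=> w _; rewrite lee_fin sqr_ge0.
  - exact: measurable_int (L2X_int i).
  - by move=> w _; rewrite lee_fin.
have event_sub :
    [set w | (theta <= algebraic_connectivity (ensemble_laplacian G w))%R] `<=`
    [set w | (theta <= \sum_i q i w)%R].
  move=> w /= /(le_algebraic_connectivity _ theta_gt0 domX)/(_ _ domX).
  by rewrite tinner_tapply_sum.
have m_sum : measurable [set w | (theta <= \sum_i q i w)%R].
  rewrite -[X in measurable X]setTI; apply: measurable_fun_le => //.
  exact: measurable_sum.
have m_event : measurable
    [set w | (theta <= algebraic_connectivity (ensemble_laplacian G w))%R].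
  rewrite (_ : [set w | _] = [set w | forall Z, connectivity_domain Z ->
      theta <= tinner Z (tapply (ensemble_laplacian G w) Z)]); last first.
    by apply/seteqP; split=> w /(le_algebraic_connectivity _ theta_gt0 domX).
  apply: measurable_forall_quadratic_ge => p.
  under eq_fun do rewrite sum_ffunE.
  apply: measurable_sum => i; apply/measurable_EFinP.
  exact: measurable_int (Lint i p).
apply: le_trans (le_measure P (mem_set m_event) (mem_set m_sum) event_sub) _.
apply: le_trans
  (bennett mq q_indep q_int q_mean q2_int q_le1 sigma2_gt0 q_var theta_gt0) _.
(* The scalar bound has prefactor 1. *)
rewrite lee_fin -mulrA ler_peMl ?mulr_ge0 ?expR_ge0 ?powR_ge0//.
have : ((m`! %/ (m - M)`!)%:R <= (m ^ M)%:R :> R).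
  by rewrite ler_nat -ffact_factd ?(ltnW hm)// ffact_le_expn.
by lra.
Qed.
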